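(* The map $f\mapsto s(f^\vartriangle)$, defined for finitely supported $f:\mathbb Z_+\to\mathbb R$, where $$f^\vartriangle(x)=\sum_{y=x}^\infty(-1)^{x+y}\binom{y}{x}f(y),\qquad s(h)=\sum_{x\in\mathbb Z_+}h(x)K_x,$$ extends to a unitary map from $\ell^2(\mathbb Z_+)$ onto $\mathcal H(K)$.
   Context: $\mathbb Z_+=\{0,1,2,\ldots\}$; $\ell^2(\mathbb Z_+)$ is the space of real square-summable sequences, and the finitely supported sequences are dense in it. $K(x,y)=\binom{x+y}{x}=\sum_{n=0}^{\min(x,y)}\binom{x}{n}\binom{y}{n}$ is positive definite on $\mathbb Z_+$; $\mathcal H(K)$ is the reproducing kernel Hilbert space of real-valued functions on $\mathbb Z_+$ with reproducing kernel $K$, and $K_x=K(\cdot,x)\in\mathcal H(K)$. If $f$ has finite support so does $f^\vartriangle$, so all sums are finite. Unitary means a surjective linear isometry. *)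

(* Defs.v *)
From HB Require Import structures.
From mathcomp Require Import all_boot all_order all_algebra.
From mathcomp Require Import all_classical all_reals all_analysis.
From mathcomp Require Import ring lra.

Set Implicit Arguments.
Unset Strict Implicit.
Unset Printing Implicit Defensive.

Import Order.TTheory GRing.Theory Num.Theory.
Import numFieldNormedType.Exports.

Local Open Scope classical_set_scope.
Local Open Scope ring_scope.

Definition dot_norm (R : realType) (V : lmodType R) (d : {dot V for idfun})
    (v : V) : R :=
  Num.sqrt (d v v).

Definition dot_complete (R : realType) (V : lmodType R)
    (d : {dot V for idfun}) : Prop :=
  forall u : nat -> V,
    (forall e : R, 0 < e ->
       exists N : nat, forall m n : nat, (N <= m)%N -> (N <= n)%N ->
         dot_norm d (u m - u n) < e) ->
    exists l : V, dot_norm d (u n - l) @[n --> \oo] --> (0 : R).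

Definition unitary (R : realType) (V W : lmodType R) (dV : {dot V for idfun})
    (dW : {dot W for idfun}) (U : {linear V -> W}) : Prop :=
  (forall v : V, dot_norm dW (U v) = dot_norm dV v) /\
  (forall w : W, exists v : V, U v = w).

(* A real Hilbert space of functions X -> R (a submodule, given as a subtype
   with predicate [rkhs_pred], of the space of all functions) with reproducing
   kernel K.  By the Moore-Aronszajn uniqueness theorem both the set of functions
   and the inner product are determined by K. *)
Record rkhs (R : realType) (X : Type) (K : X -> X -> R) := Rkhs {
  rkhs_pred : pred (X -> R);
  rkhs_space :> subLmodType rkhs_pred;
  rkhs_dot : {dot rkhs_space for idfun};
  rkhs_complete : dot_complete rkhs_dot;
  rkhs_sec : X -> rkhs_space;
  rkhs_secE : forall x y : X, \val (rkhs_sec x) y = K y x;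
  rkhs_reproducing : forall (f : rkhs_space) (x : X),
    \val f x = rkhs_dot f (rkhs_sec x) }.

Definition square_summable (R : realType) : pred (nat -> R) :=
  fun f => `[< cvgn (series (fun n => f n ^+ 2)) >].

Section ell2.
Variable R : realType.
Implicit Types f g : nat -> R.

Lemma square_summableP f :
  reflect (cvgn (series (fun n => f n ^+ 2))) (f \in @square_summable R).
Proof. exact: asboolP. Qed.

Lemma cvg_seriesM f g : f \in @square_summable R -> g \in @square_summable R ->
  cvgn (series (fun n => f n * g n)).
Proof.
move=> /square_summableP cf /square_summableP cg.
apply: normed_cvg.
apply: (series_le_cvg (v_ := (fun n => f n ^+ 2) + (fun n => g n ^+ 2))).
- by move=> n; exact: normr_ge0.
- by move=> n; rewrite addr_ge0 ?sqr_ge0.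
- move=> n; change (`|f n * g n| <= f n ^+ 2 + g n ^+ 2).
  rewrite normrM -(real_normK (num_real (f n))) -(real_normK (num_real (g n))).
  have := sqr_ge0 (`|f n| - `|g n|).
  have := sqr_ge0 (`|f n| + `|g n|).
  by nra.
- exact: is_cvg_seriesD.
Qed.

Lemma square_summable_submod : submod_closed (@square_summable R).
Proof.
split=> [|a f g].
  apply/square_summableP; rewrite [X in series X](_ : _ = 0).
    rewrite (_ : series 0 = cst 0); first exact: is_cvg_cst.
    by apply/funext => n; rewrite /series/= big1.
  by apply/funext => n; rewrite expr0n.
move=> sf sg; apply/square_summableP.
rewrite [X in series X](_ : _ = a ^+ 2 *: (fun n => f n ^+ 2) +
    (a * 2) *: (fun n => f n * g n) + (fun n => g n ^+ 2)); last first.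
  apply/funext => n.
  change ((a * f n + g n) ^+ 2 =
    a ^+ 2 * f n ^+ 2 + (a * 2) * (f n * g n) + g n ^+ 2).
  by ring.
apply: is_cvg_seriesD; last exact/square_summableP.
have c1 := is_cvg_seriesZ (k := a ^+ 2) (elimT (square_summableP f) sf).
have c2 := is_cvg_seriesZ (k := a * 2) (cvg_seriesM sf sg).
exact: is_cvg_seriesD c1 c2.
Qed.

HB.instance Definition _ := GRing.isSubmodClosed.Build R (nat -> R)
  (@square_summable R) square_summable_submod.

Record ell2 := Ell2 {
  ell2_val :> nat -> R;
  ell2P : ell2_val \in @square_summable R }.

HB.instance Definition _ := [isSub for ell2_val].
HB.instance Definition _ := [Choice of ell2 by <:].
HB.instance Definition _ := [SubChoice_isSubLmodule of ell2 by <:].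

Definition ell2_dot (f g : ell2) : R := limn (series (fun n => f n * g n)).

Lemma ell2_dot_linl (g : ell2) : linear_for *%R (ell2_dot ^~ g).
Proof.
move=> a f1 f2; rewrite /ell2_dot.
have c1 := cvg_seriesM (ell2P f1) (ell2P g).
have c2 := cvg_seriesM (ell2P f2) (ell2P g).
rewrite [X in series X](_ : _ =
    a *: (fun n => f1 n * g n) + (fun n => f2 n * g n)); last first.
  apply/funext => n.
  change ((a * f1 n + f2 n) * g n = a * (f1 n * g n) + f2 n * g n).
  by ring.
by rewrite (lim_seriesD (is_cvg_seriesZ (k := a) c1) c2) (lim_seriesZ a c1).
Qed.

Lemma ell2_dotC (f g : ell2) : ell2_dot f g = ell2_dot g f.
Proof.
by rewrite /ell2_dot; congr (limn (series _)); apply/funext => n; rewrite mulrC.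
Qed.

Lemma ell2_dot_bilinear : bilinear_for *%R (idfun \; *%R) ell2_dot.
Proof.
split=> [|f a g1 g2]; first exact: ell2_dot_linl.
by rewrite ![ell2_dot f _]ell2_dotC ell2_dot_linl.
Qed.

HB.instance Definition _ := bilinear_isBilinear.Build R ell2 ell2 R
  *%R (idfun \; *%R) ell2_dot ell2_dot_bilinear.

Lemma ell2_dot_sym (f g : ell2) :
  ell2_dot f g = (-1) ^+ false * idfun (ell2_dot g f).
Proof. by rewrite expr0 mul1r ell2_dotC. Qed.

HB.instance Definition _ :=
  isHermitianSesquilinear.Build R ell2 false idfun ell2_dot ell2_dot_sym.

Lemma ell2_dot_gt0 (f : ell2) : f != 0 -> 0 < ell2_dot f f.
Proof.
move=> f0.
have [n fn0] : exists n, f n != 0.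
  apply: contrapT => /forallNP fn0; move/negP: f0; apply.
  apply/eqP/val_inj/funext => n; apply/eqP/negPn/negP; exact: fn0.
have := cvg_seriesM (ell2P f) (ell2P f).
move=> /nondecreasing_cvgn_le; rewrite /ell2_dot.
move=> /(_ _ n.+1) le_lim; apply: lt_le_trans (le_lim _).
  rewrite /series/= big_nat_recr//= ltr_wpDl//; last first.
    by rewrite -expr2 lt_neqAle sqr_ge0 eq_sym sqrf_eq0 fn0.
  by apply: sumr_ge0 => i _; rewrite -expr2 sqr_ge0.
by apply: nondecreasing_series => i _ _; rewrite -expr2 sqr_ge0.
Qed.

HB.instance Definition _ := isDotProduct.Build R ell2 ell2_dot ell2_dot_gt0.

Definition finitely_supported f : Prop := finite_set [set x | f x != 0].

Lemma finitely_supported_bounded f : finitely_supported f ->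
  exists N : nat, forall n : nat, (N <= n)%N -> f n = 0.
Proof.
move=> ff; pose s := finmap.enum_fset (fset_set [set x | f x != 0]).
exists (\max_(x <- s) x).+1 => n Nn; apply/eqP/negPn/negP => fn0.
suff : (n <= \max_(x <- s) x)%N.
  by move=> nN; move: (leq_trans Nn nN); rewrite ltnn.
apply: (leq_bigmax_seq (F := id)) => //.
by rewrite in_fset_set// inE.
Qed.

Lemma finitely_supported_square_summable f :
  finitely_supported f -> f \in @square_summable R.
Proof.
move=> /finitely_supported_bounded[N fN]; apply/square_summableP.
apply/cvg_ex; exists (series (fun n => f n ^+ 2) N).
apply: cvg_near_cst; exists N => // n /= Nn.
rewrite /series/= (big_cat_nat (n := N))//= [X in _ + X]big_nat_cond.
rewrite [X in _ + X]big1 ?addr0// => i /andP[/andP[Ni _] _].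
by rewrite fN// expr0n.
Qed.

Definition ell2_of_finitely_supported f (ff : finitely_supported f) : ell2 :=
  Ell2 (finitely_supported_square_summable ff).

End ell2.

Definition binomial_kernel (R : realType) (x y : nat) : R := 'C(x + y, x)%:R.

(* [\sum_(i \in A) F i] is the library's sum over the finitely many i in the set
   A with F i != 0 (and 0 if there are infinitely many). *)
Definition delta_transform (R : realType) (f : nat -> R) (x : nat) : R :=
  \sum_(y \in [set y : nat | (x <= y)%N]) (-1) ^+ (x + y) * 'C(y, x)%:R * f y.

Definition kernel_sum (R : realType) (X : choiceType) (K : X -> X -> R)
    (H : rkhs K) (h : X -> R) : H :=
  \sum_(x \in [set: X]) h x *: rkhs_sec H x.

(* Main.v *)
Require Import Defs.
From HB Require Import structures.
From mathcomp Require Import all_boot all_order all_algebra.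
From mathcomp Require Import all_classical all_reals all_analysis.
From mathcomp Require Import ring.

(** The map is the one that sends the standard basis vector delta_n of l^2 to
    the function b_n : y |-> 'C(y, n), so it is f |-> sum_n f n *: b_n.  The
    point is that these functions lie in the RKHS and form an orthonormal
    basis of it.

    Binomial inversion, [binomial_inversion], says that the Pascal matrix
    P = ('C(x, n)) is inverse to its signed version Q.  Vandermonde's identity,
    [binomial_kernelE], says that the kernel is the Gram product P P^T.  Put
    b_n := sum_x Q n x *: K_x.  Its value at y is then the entry (n, y) of
    Q P P^T = P^T, that is 'C(y, n) ([binomial_vecE]).  Pairing b_m with b_n
    and using the reproducing property on the sections making up b_n gives the
    entry (n, m) of Q P = 1, so the b_n are orthonormal
    ([binomial_vec_orthonormal]).  Conversely K_x = sum_n P x n *: b_n, a finite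
    sum, so the b_n determine every function of the space
    ([kernel_section_expansion]).

    The rest is Hilbert space theory, for which weak convergence is enough.
    By completeness sum_n f n *: b_n converges for square summable f
    ([riesz_fischer]); pairing the sum with itself gives the isometry.  For
    surjectivity, the coefficients of h along the b_n are square summable
    ([bessel]), and the function with these coefficients takes the same value
    as h at each x since K_x is a finite combination of the b_n.

    Finally, for finitely supported f the transform of f is Q^T f, so
    summing it against the K_x regroups into sum_n f n *: b_n
    ([kernel_sum_delta_transform]). *)

Import Order.TTheory GRing.Theory Num.Theory.
Import numFieldNormedType.Exports.
Local Open Scope classical_set_scope.
Local Open Scope ring_scope.

(** * Orthonormal series in a real inner product space *)

Section RealInnerProduct.
Context {R : realType} {V : lmodType R} {d : {dot V for idfun}}.
Implicit Types u v w : V.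

Lemma dotC u v : d u v = d v u.
Proof. by rewrite hermC expr0 mul1r. Qed.

(* The generic bilinearity lemmas leave the two scaling laws in a form on which
   ring does not act; the next lemmas fix them to the product of R. *)
Lemma dotBl u1 u2 v : d (u1 - u2) v = d u1 v - d u2 v.
Proof. exact: linearBl. Qed.

Lemma dotBr u v1 v2 : d u (v1 - v2) = d u v1 - d u v2.
Proof. exact: linearBr. Qed.

Lemma dotZl a u v : d (a *: u) v = a * d u v.
Proof. exact: linearZl_LR. Qed.

Lemma dotZr a u v : d u (a *: v) = a * d u v.
Proof. exact: linearZr_LR. Qed.

Lemma dot_suml I (r : seq I) (P : pred I) (F : I -> V) v :
  d (\sum_(i <- r | P i) F i) v = \sum_(i <- r | P i) d (F i) v.
Proof. exact: linear_sumlz. Qed.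

Lemma dot_sumr I (r : seq I) (P : pred I) u (F : I -> V) :
  d u (\sum_(i <- r | P i) F i) = \sum_(i <- r | P i) d u (F i).
Proof. exact: linear_sumr. Qed.

Lemma dot_ge0 u : 0 <= d u u.
Proof.
have [->|u0] := eqVneq u 0; first by rewrite linear0l.
exact/ltW/neq0_dnorm_gt0.
Qed.

Lemma dot_norm_ge0 u : 0 <= dot_norm d u.
Proof. exact: sqrtr_ge0. Qed.

Lemma sqr_dot_norm u : dot_norm d u ^+ 2 = d u u.
Proof. by rewrite sqr_sqrtr// dot_ge0. Qed.

(** Positivity of the form on the component of (d v v) u orthogonal to v,
    which is scaled so as to avoid division. *)
Lemma dot_Cauchy_Schwarz u v : `|d u v| <= dot_norm d u * dot_norm d v.
Proof.
rewrite -(@ler_pXn2r _ 2)// ?nnegrE ?mulr_ge0 ?dot_norm_ge0//.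
rewrite exprMn !sqr_dot_norm real_normK ?num_real//.
have [->|v0] := eqVneq v 0; first by rewrite !linear0r expr0n.
have dv_gt0 : 0 < d v v by exact: neq0_dnorm_gt0.
have := dot_ge0 (d v v *: u - d u v *: v).
rewrite dotBl !dotBr !dotZl !dotZr (dotC v u).
set a := d u u; set b := d u v; set c := d v v in dv_gt0 *.
rewrite [X in 0 <= X](_ : _ = c * (a * c - b ^+ 2)); last by ring.
by rewrite pmulr_rge0// subr_ge0.
Qed.

Context {e : nat -> V}.
Hypothesis e_orthonormal : forall m n, d (e m) (e n) = (m == n)%:R.

Lemma dot_orthonormal_sum (f : nat -> R) (m n k : nat) : (m <= k < n)%N ->
  d (\sum_(m <= i < n) f i *: e i) (e k) = f k.
Proof.
move=> mkn; rewrite dot_suml (bigD1_seq k) ?mem_index_iota ?iota_uniq//=.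
rewrite dotZl e_orthonormal eqxx mulr1 big1 ?addr0// => i ik.
by rewrite dotZl e_orthonormal (negbTE ik) mulr0.
Qed.

Lemma pythagoras (f : nat -> R) (m n : nat) :
  d (\sum_(m <= i < n) f i *: e i) (\sum_(m <= i < n) f i *: e i) =
  \sum_(m <= i < n) f i ^+ 2.
Proof.
rewrite dot_sumr; apply: eq_big_nat => i mi.
by rewrite dotZr dot_orthonormal_sum.
Qed.

(** The partial sums of the squares are bounded by d v v, because v minus its
    projection on e 0, ..., e N.-1 has nonnegative norm. *)
Lemma bessel (v : V) : (fun n => d v (e n)) \in @square_summable R.
Proof.
apply/square_summableP; apply: nondecreasing_is_cvgn.
  by apply: nondecreasing_series => i _ _; exact: sqr_ge0.
exists (d v v) => _ [N _ <-]; rewrite /series/=.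
pose S := \sum_(0 <= i < N) d v (e i) *: e i.
have dSv : d v S = \sum_(0 <= i < N) d v (e i) ^+ 2.
  by rewrite dot_sumr; apply: eq_bigr => i _; rewrite dotZr.
have := dot_ge0 (v - S).
rewrite dotBl !dotBr (dotC S v) pythagoras dSv.
by rewrite subrr subr0 subr_ge0.
Qed.

(** By [pythagoras] the partial sums of sum_n f n *: e n are Cauchy as soon as
    those of sum_n f n ^+ 2 are; their limit is characterized by its inner
    products with all vectors, which is the only form in which convergence is
    used afterwards. *)
Lemma riesz_fischer (f : nat -> R) :
    dot_complete d -> f \in @square_summable R ->
  exists l : V, forall v, series (fun n => f n * d (e n) v) @ \oo --> d l v.
Proof.
move=> complete /square_summableP cf.
pose S N := \sum_(0 <= i < N) f i *: e i.
have homo_s : {homo series (fun n => f n ^+ 2) : m n / (m <= n)%N >-> m <= n}.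
  by apply: nondecreasing_series => i _ _; exact: sqr_ge0.
have cauchyS (r : R) : 0 < r -> exists N : nat, forall m n : nat,
    (N <= m)%N -> (N <= n)%N -> dot_norm d (S m - S n) < r.
  move=> r0; have r2 : 0 < r ^+ 2 by rewrite exprn_gt0.
  move/cvgrPdist_lt: (cf) => /(_ _ r2)[N _ HN].
  have le (m n : nat) : (N <= m)%N -> (m <= n)%N ->
      dot_norm d (S n - S m) < r.
    move=> Nm mn; rewrite /S (big_cat_nat (leq0n m) mn)//= [X in dot_norm d X]addrC addKr.
    rewrite -(@ltr_pXn2r _ 2)// ?nnegrE ?dot_norm_ge0 ?(ltW r0)//.
    rewrite sqr_dot_norm pythagoras.
    have := HN m Nm; rewrite /= ger0_norm; last first.
      by rewrite subr_ge0; exact: nondecreasing_cvgn_le.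
    apply: le_lt_trans; rewrite lerBrDl.
    have := nondecreasing_cvgn_le homo_s cf n.
    by rewrite {1 2}/series/= (big_cat_nat (leq0n m) mn).
  exists N => m n Nm Nn; have [mn|/ltnW nm] := leqP m n; last exact: le.
  rewrite (_ : dot_norm d _ = dot_norm d (S n - S m)); first exact: le.
  by rewrite /dot_norm -opprB hnormN.
have [l Sl] := complete S cauchyS; exists l => v.
have -> : series (fun n => f n * d (e n) v) = (fun N => d (S N) v).
  apply/funext => N; rewrite dot_suml /series/=.
  by apply: eq_bigr => i _; rewrite dotZl.
apply/subr_cvg0/norm_cvg0P.
apply: (@squeeze_cvgr _ _ _ _ (cst 0)
    (fun N => dot_norm d (S N - l) * dot_norm d v)).
- apply: nearW => N; rewrite normr_ge0/= -dotBl.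
  exact: dot_Cauchy_Schwarz.
- exact: cvg_cst.
- by rewrite -[0](mul0r (dot_norm d v)); exact: cvgMl.
Qed.

End RealInnerProduct.

(** * Binomial inversion and the factorization of the kernel *)

Section BinomialIdentities.
Variable R : realType.

Lemma coef_XD1_expn (n k : nat) : (('X + 1) ^+ n : {poly R})`_k = 'C(n, k)%:R.
Proof.
rewrite exprD1n coef_sum.
under eq_bigr do rewrite coefMn coefXn.
have [kn|nk] := ltnP k n.+1.
  rewrite (bigD1 (Ordinal kn))//= eqxx big1 ?addr0// => i ik.
  by rewrite [_ == _](negbTE _) ?mul0rn// eq_sym.
rewrite bin_small// big1// => i _.
by rewrite gtn_eqF ?mul0rn// (leq_trans (ltn_ord i)).
Qed.

(** Both sides are the coefficients of degree k in 'X^n = (- 1 + ('X + 1)) ^+ n,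
    expanded by the binomial formula in powers of 'X + 1. *)
Lemma binomial_inversion (n k : nat) :
  \sum_(x < n.+1) (-1) ^+ (x + n) * 'C(n, x)%:R * 'C(x, k)%:R = (n == k)%:R :> R.
Proof.
rewrite eq_sym -coefXn (_ : 'X^n = ((- 1)%:P + ('X + 1)) ^+ n); last first.
  by congr (_ ^+ n); rewrite polyCN; ring.
rewrite exprDn coef_sum; apply: eq_bigr => x _.
rewrite coefMn -polyC_exp coefCM coef_XD1_expn -[RHS]mulr_natr mulrAC.
have xn : (x <= n)%N by rewrite -ltnS.
by rewrite -signr_odd -[in RHS]signr_odd oddB// oddD addbC.
Qed.

(** Vandermonde's identity for 'C(x + y, y), after the symmetry
    'C(y, y - n) = 'C(y, n). *)
Lemma binomial_kernelE (x y : nat) :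
  binomial_kernel R x y = \sum_(n < y.+1) 'C(y, n)%:R * 'C(x, n)%:R.
Proof.
rewrite /binomial_kernel -(bin_sub (leq_addr y x)) addKn -binomial.Vandermonde natr_sum.
by apply: eq_bigr => n _; rewrite natrM mulrC (bin_sub (leq_ord n)).
Qed.

Lemma binomial_kernelC (x y : nat) :
  binomial_kernel R x y = binomial_kernel R y x.
Proof.
by rewrite /binomial_kernel -(bin_sub (leq_addr y x)) addKn addnC.
Qed.

End BinomialIdentities.

(** * The orthonormal basis of binomial functions and the unitary map *)

Section Unitary.
Context {R : realType} (H : rkhs (@binomial_kernel R)).

Let dot := rkhs_dot H.

(** The function y |-> 'C(y, n), see [binomial_vecE].  It is built from kernel
    sections so that it belongs to H by construction and its inner products are
    computed by the reproducing property; moreover f |-> kernel_sum H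
    (delta_transform f) visibly maps delta_n to it. *)
Definition binomial_vec (n : nat) : H :=
  \sum_(x < n.+1) ((-1) ^+ (x + n) * 'C(n, x)%:R) *: rkhs_sec H x.

Lemma val_sum I (r : seq I) (P : pred I) (F : I -> H) y :
  \val (\sum_(i <- r | P i) F i) y = \sum_(i <- r | P i) \val (F i) y.
Proof. by rewrite raddf_sum; elim/big_rec2: _ => //= i a b _ <-. Qed.

Lemma valZ a (h : H) y : \val (a *: h) y = a * \val h y.
Proof. by rewrite linearZ. Qed.

(** Expanding each section by [binomial_kernelE] and exchanging the two sums,
    the inner one is the inversion sum, which selects the term k = n; for n > y
    that term is out of range, in agreement with 'C(y, n) = 0. *)
Lemma binomial_vecE n y : \val (binomial_vec n) y = 'C(y, n)%:R.
Proof.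
rewrite val_sum.
under eq_bigr => x _.
  rewrite valZ rkhs_secE binomial_kernelC binomial_kernelE mulr_sumr.
  under eq_bigr do rewrite mulrCA mulrC.
  over.
rewrite exchange_big/=.
under eq_bigr => k _ do rewrite -mulr_suml binomial_inversion.
have [ny|yn] := ltnP n y.+1.
  rewrite (bigD1 (Ordinal ny))//= eqxx mul1r big1 ?addr0// => i ni.
  by rewrite [_ == _](negbTE _) ?mul0r// eq_sym.
rewrite bin_small// big1// => i _.
by rewrite gtn_eqF ?mul0r// (leq_trans (ltn_ord i)).
Qed.

Lemma binomial_vec_orthonormal m n :
  dot (binomial_vec m) (binomial_vec n) = (m == n)%:R.
Proof.
rewrite [X in dot _ X]/binomial_vec dot_sumr eq_sym -binomial_inversion.
by apply: eq_bigr => y _; rewrite dotZr -rkhs_reproducing binomial_vecE.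
Qed.

Lemma kernel_section_expansion x :
  rkhs_sec H x = \sum_(n < x.+1) 'C(x, n)%:R *: binomial_vec n.
Proof.
apply/val_inj/funext => y; rewrite rkhs_secE binomial_kernelE val_sum.
by apply: eq_bigr => n _; rewrite valZ binomial_vecE.
Qed.

(** The pointwise value of sum_n f n *: binomial_vec n, a finite sum at each y
    whether or not f is summable in any sense. *)
Definition binomial_transform (f : nat -> R) (y : nat) : R :=
  \sum_(n < y.+1) 'C(y, n)%:R * f n.

(** All truncations beyond y agree: 'C(y, n) = 0 for n > y. *)
Lemma binomial_transform_series (f : nat -> R) {y N : nat} : (y < N)%N ->
  \sum_(n < N) f n * 'C(y, n)%:R = binomial_transform f y.
Proof.
move=> yN; rewrite -(big_mkord xpredT (fun n => f n * 'C(y, n)%:R)).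
rewrite (big_cat_nat (n := y.+1))//= [X in _ + X]big_nat.
rewrite [X in _ + X]big1 ?addr0; last first.
  by move=> n /andP[yn _]; rewrite bin_small ?mulr0.
by rewrite big_mkord; apply: eq_bigr => n _; rewrite mulrC.
Qed.

Definition binomial_map (f : ell2 R) : H :=
  projT1 (cid (riesz_fischer binomial_vec_orthonormal _
    (@rkhs_complete _ _ _ H) (ell2P f))).

Lemma cvg_dot_binomial_map (f : ell2 R) (h : H) :
  series (fun n => f n * dot (binomial_vec n) h) @ \oo --> dot (binomial_map f) h.
Proof. by rewrite /binomial_map; case: cid => /= l; apply. Qed.

(** Evaluation at y is the pairing with the section at y, along which the
    defining series is eventually constant.  So the limit, which is obtained
    by choice, is an explicit function that depends linearly on f. *)
Lemma binomial_mapE f : \val (binomial_map f) = binomial_transform f.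
Proof.
apply/funext => y; rewrite rkhs_reproducing.
apply: (cvg_unique _ (cvg_dot_binomial_map f (rkhs_sec H y))) => //.
apply: cvg_near_cst; exists y.+1 => // N /= yN.
rewrite /series/= big_mkord -(binomial_transform_series _ yN).
by apply: eq_bigr => n _; rewrite -rkhs_reproducing binomial_vecE.
Qed.

Lemma binomial_map_linear : linear binomial_map.
Proof.
move=> a f g; apply/val_inj/funext => y.
transitivity (a * \val (binomial_map f) y + \val (binomial_map g) y); last first.
  by rewrite linearP.
rewrite !binomial_mapE /binomial_transform.
rewrite mulr_sumr -big_split/=; apply: eq_bigr => n _.
by rewrite mulrCA -mulrDr.
Qed.

HB.instance Definition _ :=
  GRing.isLinear.Build R (ell2 R) H _ binomial_map binomial_map_linear.

Lemma dot_binomial_map_vec (f : ell2 R) n :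
  dot (binomial_map f) (binomial_vec n) = f n.
Proof.
apply: (cvg_unique _ (cvg_dot_binomial_map f (binomial_vec n))) => //.
apply: cvg_near_cst; exists n.+1 => // N /= nN.
rewrite /series/= big_mkord (bigD1 (Ordinal nN))//= binomial_vec_orthonormal.
rewrite eqxx mulr1 big1 ?addr0// => i ni.
by rewrite binomial_vec_orthonormal [_ == _](negbTE ni) mulr0.
Qed.

(** Weak convergence of the defining series tested on its own sum: the terms
    become f n * f n by [dot_binomial_map_vec]. *)
Lemma dot_binomial_map (f : ell2 R) :
  dot (binomial_map f) (binomial_map f) = ell2_dot f f.
Proof.
apply/esym/cvg_lim => //.
rewrite (_ : (fun n => f n * f n) =
    fun n => f n * dot (binomial_vec n) (binomial_map f)).
  exact: cvg_dot_binomial_map.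
by apply/funext => n; rewrite [dot _ _]dotC dot_binomial_map_vec.
Qed.

(** The preimage of h is the sequence of its coefficients along the
    orthonormal family; both functions have the same value at y because the
    section at y is a finite combination of that family. *)
Lemma binomial_map_surjective (h : H) : exists f, binomial_map f = h.
Proof.
exists (Ell2 (bessel binomial_vec_orthonormal h)).
apply/val_inj/funext => y; rewrite binomial_mapE rkhs_reproducing.
rewrite kernel_section_expansion dot_sumr.
by apply: eq_bigr => n _; rewrite dotZr.
Qed.

Lemma binomial_map_unitary : unitary (@ell2_dot R) dot binomial_map.
Proof.
split; last exact: binomial_map_surjective.
by move=> f; rewrite /dot_norm dot_binomial_map.
Qed.

Lemma fsbig_bounded {V : nmodType} {F : nat -> V} {A : set nat} (N : nat) :
  (forall i, ~ A i -> F i = 0) -> (forall i, (N <= i)%N -> F i = 0) ->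
  \sum_(i \in A) F i = \sum_(i < N) F i.
Proof.
move=> FA FN; rewrite fsbig_ord (@fsbig_widen _ _ _ _ A setT)//; last first.
  by move=> i [_ /= /FA].
rewrite [RHS](@fsbig_widen _ _ _ _ `I_N setT)// => i [_ /= /negP].
by rewrite -leqNgt => /FN.
Qed.

(** With the support of f below N, both sides equal sum_(n < N) f n *:
    binomial_vec n; for the left-hand side this is an exchange of two finite
    sums. *)
Lemma kernel_sum_delta_transform (f : nat -> R) (ff : finitely_supported f) :
  kernel_sum H (delta_transform f) =
  binomial_map (ell2_of_finitely_supported ff).
Proof.
have [N fN] := finitely_supported_bounded ff.
have deltaE x : delta_transform f x =
    \sum_(y < N) (-1) ^+ (x + y) * 'C(y, x)%:R * f y.
  apply: (fsbig_bounded N (F := fun y => (-1) ^+ (x + y) * 'C(y, x)%:R * f y)).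
  - by move=> y /negP; rewrite -ltnNge => yx; rewrite bin_small// mulr0 mul0r.
  - by move=> y /fN ->; rewrite mulr0.
rewrite /kernel_sum (fsbig_bounded N); last 2 first.
- by move=> x [].
- move=> x Nx; rewrite deltaE big1 ?scale0r// => y _.
  by rewrite bin_small ?mulr0 ?mul0r// (leq_trans (ltn_ord y)).
transitivity (\sum_(n < N) f n *: binomial_vec n).
  under eq_bigr do rewrite deltaE scaler_suml.
  rewrite exchange_big/=; apply: eq_bigr => n _; rewrite /binomial_vec scaler_sumr.
  pose F x := f n *: (((-1) ^+ (x + n) * 'C(n, x)%:R) *: rkhs_sec H x).
  rewrite -/(F _) (big_ord_widen N F (ltn_ord n)) [RHS]big_mkcond/=.
  apply: eq_bigr => x _; rewrite /F; case: ltnP => xn.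
    by rewrite scalerA [f n * _]mulrC.
  by rewrite bin_small ?mulr0 ?mul0r ?scale0r.
apply/val_inj/funext => y; rewrite binomial_mapE val_sum.
have [yN|Ny] := ltnP y N.
  rewrite -(binomial_transform_series _ yN).
  by apply: eq_bigr => n _; rewrite valZ binomial_vecE.
(* Beyond the support of f, it is the left-hand sum that has to be extended,
   by the terms N <= n <= y, on which f vanishes. *)
rewrite /binomial_transform (big_ord_widen y.+1
  (fun n => \val (f n *: binomial_vec n) y)) ?(leq_trans Ny)//.
rewrite big_mkcond; apply: eq_bigr => n _; rewrite valZ binomial_vecE mulrC.
by case: ltnP => // /fN /= ->; rewrite mulr0.
Qed.

End Unitary.

Theorem theorem4p5 (R : realType) (H : rkhs (@binomial_kernel R)) :
  exists U : {linear ell2 R -> H},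
    unitary (@ell2_dot R) (rkhs_dot H) U /\
    forall (f : nat -> R) (ff : finitely_supported f),
      U (ell2_of_finitely_supported ff) = kernel_sum H (delta_transform f).
Proof.
exists (binomial_map H); split; first exact: binomial_map_unitary.
by move=> f ff; rewrite kernel_sum_delta_transform.
Qed.
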